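(* Let $1\le p\le+\infty$, assume that $B$ is $p$-boundary admissible, let $t>0$ and $n\in\{1,2,3,\dots\}$. Then the exact reachability space in time $nt$ is given by $$e\mathcal R^{\mathrm{BC}}_{nt}=\Bigl\{\sum_{k=0}^{n-1}T(t)^kMu_k:\ u_k\in L^p([0,t],U),\ 0\le k\le n-1\Bigr\},$$ where $M:=\mathcal B_t^{\mathrm{BC}}\in\mathcal L\bigl(L^p([0,t],U),X\bigr)$ is the controllability map at time $t$.
   Context: Abstract setting. $X$, $\partial X$, $U$ are Banach spaces; $A_m:D(A_m)\subseteq X\to X$ is a closed, densely defined operator; $Q\in\mathcal L([D(A_m)],\partial X)$, where $[D(A_m)]$ is $D(A_m)$ with the graph norm; $B\in\mathcal L(U,\partial X)$. Standing assumptions: (i) the restriction $A\subset A_m$ with domain $D(A):=\ker Q$ generates a strongly continuous semigroup $(T(t))_{t\ge0}$ on $X$; (ii) $Q:D(A_m)\to\partial X$ is surjective. For $\lambda\in\rho(A)$ the restriction $Q|_{\ker(\lambda-A_m)}$ is invertible with bounded inverse $Q_\lambda:\partial X\to\ker(\lambda-A_m)\subseteq X$, and $B_\lambda:=Q_\lambda B\in\mathcal L(U,X)$. $B$ is called $p$-boundary admissible if there exist $t>0$ and $\lambda\in\rho(A)$ such that $\int_0^tT(t-s)B_\lambda u(s)\,ds\in D(A)$ for all $u\in L^p([0,t],U)$; the same then holds for every $t>0$ and $\lambda\in\rho(A)$. In this case, for $t>0$ the controllability map $\mathcal B_t^{\mathrm{BC}}\in\mathcal L(L^p([0,t],U),X)$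 is $\mathcal B_t^{\mathrm{BC}}u:=(\lambda-A)\int_0^tT(t-s)B_\lambda u(s)\,ds$, which does not depend on $\lambda\in\rho(A)$. The exact reachability space in time $t$ is $e\mathcal R^{\mathrm{BC}}_t:=\operatorname{rg}(\mathcal B_t^{\mathrm{BC}})$ (the range). *)

(* Defs.v *)
From HB Require Import structures.
From mathcomp Require Import all_boot all_order all_algebra.
From mathcomp Require Import all_classical all_reals all_analysis.
From mathcomp Require Import complex.

Set Implicit Arguments.
Unset Strict Implicit.
Unset Printing Implicit Defensive.

Import Order.TTheory GRing.Theory Num.Theory.
Import numFieldNormedType.Exports.

Local Open Scope classical_set_scope.
Local Open Scope ring_scope.

(* Scalar fields of Banach spaces: the real and the complex numbers, treated
   uniformly (instances below).  In MathComp-Analysis the norm of a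
   [normedModType K] takes its values in [K]; [to_real] reads them in [R].  By
   the Gelfand-Mazur theorem every instance is isomorphic to R or to R[i]. *)
Record scalarField (R : realType) := ScalarField {
  scalar :> numFieldType ;
  of_real : {rmorphism R -> scalar} ;
  to_real : scalar -> R ;
  of_real_mono : {mono of_real : x y / x <= y} ;
  of_realK : cancel of_real to_real ;
  norm_is_real : forall z : scalar, of_real (to_real `|z|) = `|z|
}.

Lemma real_norm_is_real (R : realType) (z : R) : idfun `|z| = `|z|.
Proof. by []. Qed.

Definition real_scalars (R : realType) : scalarField R :=
  @ScalarField R R idfun id (fun _ _ => erefl) (fun _ => erefl)
    (@real_norm_is_real R).

Lemma complex_norm_is_real (R : realType) (z : R[i]) :
  real_complex R (complex.Re `|z|) = `|z|.
Proof. by rewrite normc_def. Qed.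

Lemma real_complex_mono (R : realType) :
  {mono real_complex R : x y / x <= y}.
Proof. by move=> x y; rewrite lecE /= eqxx. Qed.

Definition complex_scalars (R : realType) : scalarField R :=
  @ScalarField R R[i] (real_complex R) (@complex.Re R)
    (@real_complex_mono R) (fun _ => erefl) (@complex_norm_is_real R).

Section BochnerIntegral.
Context {R : realType} {K : scalarField R}.
Local Notation mu := (@lebesgue_measure R).

Definition rnorm {V : normedModType K} (x : V) : R := to_real `|x|.

Definition measurable_simple {V : normedModType K} (s : {fimfun R >-> V}) :=
  forall v : V, measurable (s @^-1` [set v]).

(* The convergence holds almost everywhere, so [rnorm \o f] need only be Lebesgue
   (not Borel) measurable.  The library integral of a nonnegative function is a
   supremum over the simple functions below it, which gives such functions their
   usual Lebesgue integral. *)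
Definition strongly_measurable {V : normedModType K} (D : set R) (f : R -> V) :=
  exists2 s : nat -> {fimfun R >-> V},
    forall n, measurable_simple (s n) &
    {ae mu, forall r, D r -> s n r @[n --> \oo] --> f r}.

Definition simple_integrable {V : normedModType K} (D : set R)
    (s : {fimfun R >-> V}) :=
  measurable_simple s /\
  forall v : V, v != 0 -> (mu (D `&` s @^-1` [set v]) < +oo)%E.

Definition simple_integral {V : normedModType K} (D : set R)
    (s : {fimfun R >-> V}) : V :=
  \sum_(v \in range s) (of_real K (fine (mu (D `&` s @^-1` [set v]))) *: v).

Definition is_bochner_integral {V : normedModType K} (D : set R)
    (f : R -> V) (x : V) :=
  strongly_measurable D f /\
  exists s : nat -> {fimfun R >-> V},
  [/\ forall n, simple_integrable D (s n),
      (\int[mu]_(r in D) (rnorm (f r - s n r))%:E)%E @[n --> \oo] --> 0%E &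
      simple_integral D (s n) @[n --> \oo] --> x].

Definition bochner_integrable {V : normedModType K} (D : set R) (f : R -> V) :=
  exists x, is_bochner_integral D f x.

Definition bochner_integral {V : normedModType K} (D : set R) (f : R -> V) : V :=
  xget 0 [set x | is_bochner_integral D f x].

(* Functions representing the elements of L^p([0,t],V).  The quotient by a.e.
   equality is not taken: the Bochner integral only depends on the class. *)
Definition Lp {V : normedModType K} (p : \bar R) (t : R) : set (R -> V) :=
  [set u | strongly_measurable `[0, t] u /\
    ('N[mu]_p[(fun s => (rnorm (u s))%:E) \_ `[0%R, t]] < +oo)%E].

End BochnerIntegral.

Section Operators.
Context {R : realType} {K : scalarField R} {X dX : normedModType K}.

(* Only the values of [op] on [dom] are meaningful. *)
Record partial_op := PartialOp { dom : set X ; op :> X -> X }.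

Definition linear_op (A : partial_op) :=
  dom A 0 /\
  forall (a : K) (x y : X), dom A x -> dom A y ->
    dom A (a *: x + y) /\ A (a *: x + y) = a *: A x + A y.

Definition closed_op (A : partial_op) :=
  closed [set z : X * X | dom A z.1 /\ A z.1 = z.2].

(* Q belongs to L([D(A)], dX), [D(A)] carrying the graph norm of A. *)
Definition graph_bounded (A : partial_op) (Q : X -> dX) :=
  (forall (a : K) (x y : X), dom A x -> dom A y ->
     Q (a *: x + y) = a *: Q x + Q y) /\
  exists C : R, forall x, dom A x -> rnorm (Q x) <= C * (rnorm x + rnorm (A x)).

Definition ker_restriction (A : partial_op) (Q : X -> dX) : partial_op :=
  PartialOp [set x | dom A x /\ Q x = 0] A.

Definition C0_semigroup (T : R -> {linear X -> X}) :=
  [/\ forall t, 0 <= t -> continuous (T t),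
      forall x, T 0 x = x,
      forall s t x, 0 <= s -> 0 <= t -> T (s + t) x = T s (T t x) &
      forall x, {within `[0, +oo[, continuous (fun t => T t x)}].

Definition generator (T : R -> {linear X -> X}) (A : partial_op) :=
  forall x y, (dom A x /\ A x = y) <->
    (of_real K h)^-1 *: (T h x - x) @[h --> 0^'+] --> y.

Definition resolvent_set (A : partial_op) : set K :=
  [set lambda | exists Rl : {linear X -> X},
    [/\ continuous Rl,
        forall y, dom A (Rl y) /\ lambda *: Rl y - A (Rl y) = y &
        forall x, dom A x -> Rl (lambda *: x - A x) = x]].

(* Q_lambda, the inverse of the restriction of Q to ker (lambda - Am). *)
Definition dirichlet_op (Am : partial_op) (Q : X -> dX) (lambda : K) (v : dX)
    : X :=
  xget 0 [set x | [/\ dom Am x, lambda *: x - Am x = 0 & Q x = v]].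

End Operators.

Arguments partial_op {R K} X.

Section BoundaryControl.
Context {R : realType} {K : scalarField R} {X dX U : normedModType K}.
Variables (Am : partial_op X) (Q : X -> dX) (B : U -> dX).
Variable T : R -> {linear X -> X}.

Let A := ker_restriction Am Q.

Definition control_integrand (lambda : K) (t : R) (u : R -> U) (s : R) : X :=
  T (t - s) (dirichlet_op Am Q lambda (B (u s))).

(* Integrability is part of the assertion that the integral lies in D(A): the
   default value 0 of [bochner_integral] never counts as a value. *)
Definition boundary_admissible (p : \bar R) :=
  exists t (lambda : K), [/\ 0 < t, resolvent_set A lambda &
    forall u, Lp p t u ->
      bochner_integrable `[0, t] (control_integrand lambda t u) /\
      dom A (bochner_integral `[0, t] (control_integrand lambda t u))].

(* Under admissibility this does not depend on [lambda] in the resolvent set. *)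
Definition controllability_map (lambda : K) (t : R) (u : R -> U) : X :=
  let x := bochner_integral `[0, t] (control_integrand lambda t u) in
  lambda *: x - A x.

Definition exact_reachability_space (lambda : K) (p : \bar R) (t : R) : set X :=
  controllability_map lambda t @` Lp p t.

End BoundaryControl.

(* Main.v *)
(* Splitting the integral over [0, a + b] at a, and using T(b) for the first
   piece, gives I_{a+b}(u) = T(b) I_a(u) + I_b(u(a + .)).  Since T(b) preserves
   D(A) and commutes with A there, this passes to the controllability maps, and
   iterating it on [0, nt] yields one inclusion; the other holds because
   concatenations of L^p controls are L^p controls.

   Admissibility is assumed for one time and one lambda only.  It passes to all
   lambda because Q_lambda = (1 + (lambda0 - lambda) R(lambda, A)) Q_lambda0, to
   smaller times by extending controls by 0 on the left, and to larger times by
   the splitting formula. *)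
Require Import Defs.
From mathcomp Require Import all_boot all_order all_algebra.
From mathcomp Require Import all_classical all_reals all_analysis.
From mathcomp Require Import measurable_realfun lra ring.

Set Implicit Arguments.
Unset Strict Implicit.
Unset Printing Implicit Defensive.

Import Order.TTheory GRing.Theory Num.Theory.
Import numFieldNormedType.Exports.

Local Open Scope classical_set_scope.
Local Open Scope ring_scope.

(** * Real-valued norms *)

Section Rnorm.
Context {R : realType} {K : scalarField R}.
Implicit Types V W : normedModType K.

(** Integrability is never derived from regularity of the integrand: it comes with admissibility and
    is carried, together with membership in the domain, through every change of time or of [lambda]
    ([admissible_at]). Each integral over [[0, t]] becomes one over the whole line after extension
    by zero. Off the single point [a], the extension of an integrand over [[0, a + b]] is the sum of
    an extension over [[0, a]] and a translate of one over [[0, b]]. Splitting thus needs only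
    additivity, translation invariance and the passage of bounded operators under the integral. The
    obstacle is measurability: [rnorm (f r - s n r)] need not be Borel, and for such functions only
    monotonicity of the integral is immediate. Additivity and translation are therefore applied to
    Borel majorants, in [has_integral] as well as in [pdominated]. *)

Lemma of_real_rnorm V (x : V) : of_real K (rnorm x) = `|x|.
Proof. by rewrite /rnorm -normr_id norm_is_real. Qed.

Lemma of_real_lt (x y : R) : (of_real K x < of_real K y) = (x < y).
Proof. exact: leW_mono (of_real_mono K) x y. Qed.

Lemma rnorm_ge0 V (x : V) : 0 <= rnorm x.
Proof. by rewrite -(of_real_mono K) rmorph0 of_real_rnorm. Qed.

Lemma rnorm0 V : rnorm (0 : V) = 0.
Proof. by rewrite /rnorm normr0 -(rmorph0 (of_real K)) of_realK. Qed.

Lemma rnorm_eq0 V (x : V) : rnorm x <= 0 -> x = 0.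
Proof.
move=> x0; have /eqP := le_anti (introT andP (conj x0 (rnorm_ge0 x))).
move=> /eqP /(congr1 (of_real K)); rewrite of_real_rnorm rmorph0.
by move/eqP; rewrite normr_eq0 => /eqP.
Qed.

Lemma rnormD V (x y : V) : rnorm (x + y) <= rnorm x + rnorm y.
Proof. by rewrite -(of_real_mono K) rmorphD !of_real_rnorm ler_normD. Qed.

Lemma rnormN V (x : V) : rnorm (- x) = rnorm x.
Proof. by rewrite /rnorm normrN. Qed.

Lemma rnormB V (x y : V) : rnorm (x - y) = rnorm (y - x).
Proof. by rewrite -rnormN opprB. Qed.

Lemma rnormZ V (c : R) (x : V) : 0 <= c -> rnorm (of_real K c *: x) = c * rnorm x.
Proof.
move=> c0; rewrite /rnorm normrZ ger0_norm; last first.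
  by have := of_real_mono K 0 c; rewrite rmorph0 => ->.
by rewrite -(of_real_rnorm x) -rmorphM !of_realK.
Qed.

Lemma rnorm_sum V (I : Type) (r : seq I) (F : I -> V) :
  rnorm (\sum_(i <- r) F i) <= \sum_(i <- r) rnorm (F i).
Proof.
elim: r => [|i r IH]; first by rewrite !big_nil rnorm0.
by rewrite !big_cons; apply: le_trans (rnormD _ _) _; rewrite lerD2l.
Qed.

(** A positive scalar equals its own norm and so comes from [R]; hence real radii test convergence
    as well as radii in [K]. *)
Lemma cvg_rnormP V (T : Type) (F : set_system T) (FF : Filter F)
    (f : T -> V) (l : V) :
  f x @[x --> F] --> l <-> forall e : R, 0 < e -> \forall x \near F, rnorm (f x - l) < e.
Proof.
split=> [/cvgrPdist_lt fl e e0|fl].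
  have := fl (of_real K e); rewrite -(rmorph0 (of_real K)) of_real_lt => /(_ e0).
  apply: filterS => x; rewrite -of_real_rnorm of_real_lt.
  by rewrite rnormB.
apply/cvgrPdist_lt => e e0.
have eE : e = of_real K (to_real e).
  by rewrite -{1}(gtr0_norm e0) -norm_is_real (gtr0_norm e0).
have := fl (to_real e); rewrite -of_real_lt rmorph0 -eE => /(_ e0).
by apply: filterS => x; rewrite -of_real_lt -eE of_real_rnorm distrC.
Qed.

Lemma cvg_rnorm V (T : Type) (F : set_system T) (FF : Filter F)
    (f : T -> V) (l : V) :
  f x @[x --> F] --> l -> rnorm (f x) @[x --> F] --> rnorm l.
Proof.
move=> /cvg_rnormP fl; apply/cvgrPdist_lt => e e0.
apply: filterS (fl e e0) => x; apply: le_lt_trans.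
rewrite ler_norml; have := rnormD (f x - l) l; have := rnormD (l - f x) (f x).
rewrite !subrK (rnormB l); lra.
Qed.

Lemma continuous_linear_rnorm V W (L : {linear V -> W}) :
  continuous L -> exists2 C : R, 0 <= C & forall x, rnorm (L x) <= C * rnorm x.
Proof.
move=> cL; have /cvg_rnormP := cL 0.
move=> /(_ 1 ltr01); rewrite linear0 => /nbhs_ballP[_/posnumP[e] ballL].
have eE : e%:num = of_real K (to_real e%:num).
  by rewrite -{1}(gtr0_norm (gt0 e)) -norm_is_real (gtr0_norm (gt0 e)).
set d := to_real e%:num in eE.
have d0 : 0 < d by rewrite -(of_real_lt) -eE rmorph0.
(* A vector scaled to norm [d / 2] lies in the ball of radius [d] around 0, where [L] has norm below
   1. *)
exists (2 / d) => [|x]; first by rewrite divr_ge0 // ltW.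
have [x0|x0] := leP (rnorm x) 0.
  by rewrite (rnorm_eq0 x0) linear0 !rnorm0 mulr0.
have c0 : 0 < d / 2 / rnorm x by rewrite !divr_gt0.
have : rnorm (L (of_real K (d / 2 / rnorm x) *: x) - 0) < 1.
  apply: ballL; rewrite -ball_normE /ball_ /= sub0r normrN -of_real_rnorm eE of_real_lt.
  rewrite rnormZ ?ltW // -mulrA mulVf ?gt_eqF // mulr1; lra.
rewrite subr0 linearZ (rnormZ _ (ltW c0)) => h.
by move: h; rewrite -ltr_pdivlMl // mulr1 !invf_div [2 / d * _]mulrC; exact: ltW.
Qed.

End Rnorm.

(** * Simple functions and their integrals *)

Section Simple.
Context {R : realType}.
Local Notation mu := (@lebesgue_measure R).

(** Preimages of all subsets are asked for, so that pairing and composition with arbitrary maps need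
    no structure on [W]; by finiteness of the range the fibres suffice ([simpleP]). *)
Definition simple (W : Type) (f : R -> W) :=
  finite_set (range f) /\ forall B : set W, measurable (f @^-1` B).

Lemma simpleP (W : Type) (f : R -> W) : finite_set (range f) ->
  (forall w, measurable (f @^-1` [set w])) -> simple f.
Proof.
move=> finf mf; split => // B.
have -> : f @^-1` B = \bigcup_(w in range f `&` B) f @^-1` [set w].
  apply/seteqP; split => [r Bfr|r [w [_ Bw]] /= ->//].
  by exists (f r) => //; split => //; exists r.
by apply: fin_bigcup_measurable => //; exact: finite_setIl.
Qed.

Lemma simple_comp (W W' : Type) (f : R -> W) (phi : W -> W') :
  simple f -> simple (phi \o f).
Proof.
move=> [finf mf]; split; first by rewrite -(image_comp f phi); exact: finite_image.
by move=> B; rewrite comp_preimage; exact: mf.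
Qed.

Lemma simple_pair (W W' : Type) (f : R -> W) (g : R -> W') :
  simple f -> simple g -> simple (fun r => (f r, g r)).
Proof.
move=> [finf mf] [fing mg]; apply: simpleP.
  apply: sub_finite_set (finite_setX finf fing).
  by move=> _ [r _ <-]; split; exists r.
move=> [w w'].
rewrite (_ : _ @^-1` _ = f @^-1` [set w] `&` g @^-1` [set w']).
  exact: measurableI.
by apply/seteqP; split => [r /= [-> ->]|r [/= -> ->]].
Qed.

Lemma simple_cst (W : Type) (w : W) : simple (fun _ : R => w).
Proof.
split; first by apply: sub_finite_set (finite_set1 w) => _ [r _ <-].
by move=> B; rewrite preimage_cst; case: ifPn.
Qed.

Lemma simple_mem (D : set R) : measurable D -> simple (fun r => r \in D).
Proof.
move=> mD; apply: simpleP.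
  apply: sub_finite_set (_ : finite_set [set true; false]).
    by move=> [] _; [left|right].
  by rewrite -[X in finite_set X]/(_ `|` _) finite_setU; split; exact: finite_set1.
have mDE : (fun r => r \in D) @^-1` [set true] = D.
  by apply/seteqP; split => r /= => [/set_mem|/mem_set].
move=> [|]; first by rewrite mDE.
rewrite (_ : _ @^-1` _ = ~` D); first exact: measurableC.
rewrite -[in RHS]mDE; apply/seteqP; split => r /=; first by move=> ->.
by case: (r \in D).
Qed.

End Simple.

Section SimpleIntegral.
Context {R : realType} {K : scalarField R}.
Local Notation mu := (@lebesgue_measure R).
Implicit Types V W : normedModType K.

(** The fibre over 0 is exempt because a zero extension may have infinite measure there; in [sint]
    its term is a multiple of 0. *)
Definition isimple V (f : R -> V) :=
  simple f /\ forall v, v != 0 -> (mu (f @^-1` [set v]) < +oo)%E.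

Definition sint V (f : R -> V) : V :=
  \sum_(v \in range f) (of_real K (fine (mu (f @^-1` [set v]))) *: v).

(** Since [phi 0 = 0], the fibre over [w != 0] is a finite union of fibres of [f] over nonzero
    values, each of finite measure. *)
Lemma isimple_comp V W (f : R -> V) (phi : V -> W) :
  phi 0 = 0 -> isimple f -> isimple (phi \o f).
Proof.
move=> phi0 [sf ff]; split=> [|w w0]; first exact: simple_comp.
have -> : (phi \o f) @^-1` [set w] =
    \bigcup_(v in range f `&` phi @^-1` [set w]) f @^-1` [set v].
  apply/seteqP; split => [r /= pfr|r [v [_ /= <-]] /= ->//].
  by exists (f r) => //; split => //; exists r.
have finI : finite_set (range f `&` phi @^-1` [set w]).
  by apply: finite_setIl; exact: sf.1.
rewrite -fsbig_setU //; apply: le_lt_trans.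
  rewrite measure_fsbig //; first by move=> v _; exact: sf.2.
  exact: trivIset_preimage1.
rewrite fsbig_finite //= big_seq lte_sum_pinfty // => v.
rewrite in_fset_set // inE => -[_ /= phiv]; apply: ff.
by apply: contra_not_neq (elimN eqP w0) => v0; rewrite -phiv v0.
Qed.

Lemma isimple_pair V W (f : R -> V) (g : R -> W) :
  isimple f -> isimple g -> isimple (fun r => (f r, g r) : (V * W)%type).
Proof.
move=> [sf ff] [sg fg]; split=> [|[v w] vw0]; first exact: simple_pair.
have : v != 0 \/ w != 0.
  have [v0|] := eqVneq v 0; last by left.
  have [w0|] := eqVneq w 0; last by right.
  by move: vw0; rewrite v0 w0 eqxx.
have [_ mfg] := simple_pair sf sg.
move: sf sg => [_ mf] [_ mg].
case=> [/ff|/fg]; apply: le_lt_trans; apply: le_measure; rewrite ?inE //.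
all: by [move=> r []|apply: mfg|apply: mf|apply: mg].
Qed.

(* Both sides are the sum of [mu (f @^-1` [set v]) *: phi v] over the values
   [v] of [f], grouped on the left by the value of [phi v]. *)
Lemma sint_linear V W (f : R -> V) (phi : {linear V -> W}) :
  isimple f -> sint (phi \o f) = phi (sint f).
Proof.
move=> isf; have [[finf mf] ff] := isf.
have [[finpf mpf] fpf] := isimple_comp (linear0 phi) isf.
pose c v := of_real K (fine (mu (f @^-1` [set v]))) *: phi v.
transitivity (\sum_(w \in range (phi \o f)) \sum_(v \in range f)
    (if phi v == w then c v else 0)).
  apply: eq_fsbigr => w _.
  (* The value 0 is set apart: its fibre may have infinite measure, where [fine] is not additive,
     but both sides are multiples of 0. *)
  have [->|w0] := eqVneq w 0.
    rewrite scaler0 fsbig1 // => v _; case: eqP => // phiv.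
    by rewrite /c phiv scaler0.
  have -> : (phi \o f) @^-1` [set w] =
      \bigcup_(v in range f `&` phi @^-1` [set w]) f @^-1` [set v].
    apply/seteqP; split => [r /= pfr|r [v [_ /= <-]] /= ->//].
    by exists (f r) => //; split => //; exists r.
  have finI : finite_set (range f `&` phi @^-1` [set w]) by exact: finite_setIl.
  rewrite -fsbig_setU // measure_fsbig //; last 2 first.
  - by move=> v _; exact: mf.
  - exact: trivIset_preimage1.
  rewrite fsbig_finite //= big_seq -sum_fine; last first.
    move=> v; rewrite in_fset_set // inE => -[_ /= phiv].
    rewrite ge0_fin_numE //; apply: ff.
    by apply: contra_not_neq (elimN eqP w0) => v0; rewrite -phiv v0 linear0.
  rewrite rmorph_sum scaler_suml /= -big_seq -fsbig_finite // fsbig_mkcondr.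
  apply: eq_fsbigr => v _.
  case: ifPn => [/set_mem phiv|/negP phiv]; first by rewrite /c -phiv eqxx.
  by case: eqP => // /mem_set.
have -> : phi (sint f) = \sum_(v \in range f) c v.
  rewrite /sint !fsbig_finite //= linear_sum.
  by apply: eq_bigr => v _; rewrite linearZ.
rewrite exchange_fsbig //=; apply: eq_fsbigr => v /set_mem[r _ frv].
rewrite (fsbigD1 (phi v)) /=; last 2 first.
- exact: sub_finite_set finpf.
- by exists r; rewrite //= frv.
rewrite eqxx fsbig1 ?addr0 //.
by move=> w [_ /= wv]; case: eqP => // /esym.
Qed.

End SimpleIntegral.

(** * Norm bound and additivity of the simple integral *)

Section SimpleIntegralBound.
Context {R : realType} {K : scalarField R}.
Local Notation mu := (@lebesgue_measure R).
Implicit Types V W : normedModType K.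

(** The right side is evaluated exactly, as the sum of [rnorm v] times the measure of the fibre over
    [v]; what remains is the triangle inequality for a finite sum. *)
Lemma rnorm_sint_le V (f : R -> V) : isimple f ->
  ((rnorm (sint f))%:E <= \int[mu]_r (rnorm (f r))%:E)%E.
Proof.
move=> [[finf mf] ff].
have -> : (\int[mu]_r (rnorm (f r))%:E =
    \sum_(v \in range f) (rnorm v)%:E * mu (f @^-1` [set v]))%E.
  have fE r : ((rnorm (f r))%:E =
      \sum_(v \in range f) (rnorm v)%:E * (\1_(f @^-1` [set v]) r)%:E)%E.
    rewrite (fsbigD1 (f r)) //=; last by exists r.
    rewrite indicE mem_set // mule1 fsbig1 ?adde0 // => v [_ /= vr].
    by rewrite indicE memNset ?mule0 // => /= /esym.
  under eq_integral do rewrite fE.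
  rewrite ge0_integral_fsum //; last 2 first.
  - move=> v; apply: emeasurable_funM => //.
    by apply/measurable_EFinP/measurable_indic; exact: mf [set v].
  - by move=> v r _; rewrite mule_ge0 // lee_fin ?rnorm_ge0.
  apply: eq_fsbigr => v _; rewrite ge0_integralZl_EFin ?rnorm_ge0 //.
  - by rewrite integral_indic ?setIT //; exact: mf [set v].
  - by apply/measurable_EFinP/measurable_indic; exact: mf [set v].
rewrite /sint !fsbig_finite //=.
have /= := rnorm_sum (finmap.enum_fset (fset_set (range f)))
  (fun v => of_real K (fine (mu (f @^-1` [set v]))) *: v).
rewrite -lee_fin => /le_trans; apply.
rewrite -sumEFin; apply: lee_sum => v _.
rewrite rnormZ ?fine_ge0 //.
have [->|v0] := eqVneq v 0; first by rewrite rnorm0 mulr0 mul0e.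
by rewrite EFinM fineK 1?muleC // ge0_fin_numE // ff.
Qed.

Lemma simple_rnorm_measurable V (f : R -> V) :
  simple f -> measurable_fun setT (fun r => rnorm (f r)).
Proof.
by move=> [_ mf] _ Y mY; rewrite setTI -[_ @^-1` _]/(f @^-1` (rnorm @^-1` Y)).
Qed.

Lemma isimpleB V (f g : R -> V) :
  isimple f -> isimple g -> isimple (fun r => f r - g r).
Proof.
move=> isf isg; have := isimple_pair isf isg.
by move=> /(isimple_comp (phi := fun z : V * V => z.1 - z.2)) /=; apply; rewrite subr0.
Qed.

Lemma isimpleD V (f g : R -> V) :
  isimple f -> isimple g -> isimple (fun r => f r + g r).
Proof.
move=> isf isg; have := isimple_pair isf isg.
by move=> /(isimple_comp (phi := fun z : V * V => z.1 + z.2)) /=; apply; rewrite addr0.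
Qed.

(** No common refinement of partitions is formed: both integrals and their sum are images of the
    integral of the pair under the linear maps [fst], [snd] and [fst \+ snd]. *)
Lemma sintD V (f g : R -> V) : isimple f -> isimple g ->
  sint (fun r => f r + g r) = sint f + sint g.
Proof.
move=> isf isg; have isp := isimple_pair isf isg.
have fstE : sint f = (sint (fun r => (f r, g r) : (V * V)%type)).1.
  by rewrite -(sint_linear fst isp).
have sndE : sint g = (sint (fun r => (f r, g r) : (V * V)%type)).2.
  by rewrite -(sint_linear snd isp).
by rewrite fstE sndE; exact: (sint_linear (fst \+ snd) isp).
Qed.

Lemma sintB V (f g : R -> V) : isimple f -> isimple g ->
  sint (fun r => f r - g r) = sint f - sint g.
Proof.
move=> isf isg; rewrite -[in RHS](_ : sint (fun r => f r - g r + g r) = sint f).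
  by rewrite (sintD (isimpleB isf isg) isg) addrK.
by congr sint; apply/funext => r; rewrite subrK.
Qed.

End SimpleIntegralBound.

(** * Lebesgue measure and integrals of unmeasurable functions *)

#[local] Instance lebesgue_ae_filter (R : realType) :
  Filter (almost_everywhere (@lebesgue_measure R)).
Proof. exact: ae_filter_ringOfSetsType. Qed.

Section UnmeasurableIntegrands.
Import HBNNSimple.
Context {R : realType}.
Local Notation mu := (@lebesgue_measure R).
Local Open Scope ereal_scope.

Lemma aeS (P Q : R -> Prop) : (forall r, P r -> Q r) ->
  {ae mu, forall r, P r} -> {ae mu, forall r, Q r}.
Proof. by move=> PQ aeP; apply: filterS aeP => r; exact: PQ. Qed.

Lemma aeI (P Q : R -> Prop) : {ae mu, forall r, P r} ->
  {ae mu, forall r, Q r} -> {ae mu, forall r, P r /\ Q r}.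
Proof. by move=> aeP aeQ; exact: filterI. Qed.

(** The integral is a supremum over the simple functions below, and a larger function has more of
    them; measurability does not enter. *)
Lemma le_integral_unmeasurable (f g : R -> \bar R) :
  (forall r, 0 <= f r) -> (forall r, f r <= g r) ->
  \int[mu]_r f r <= \int[mu]_r g r.
Proof.
move=> f0 fg; have g0 r : 0 <= g r by exact: le_trans (fg r).
rewrite !ge0_integralTE //; apply: ge_ereal_sup => _ [h /= hf <-].
by apply: ereal_sup_ubound; exists h => // r; exact: le_trans (hf r) (fg r).
Qed.

(** Only [g] has to be measurable: a simple function below [f] is measurable and a.e. below [g], so
    the usual comparison applies to that pair. *)
Lemma ae_le_integral_measurable (f g : R -> \bar R) :
  (forall r, 0 <= f r) -> (forall r, 0 <= g r) -> measurable_fun setT g ->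
  {ae mu, forall r, f r <= g r} -> \int[mu]_r f r <= \int[mu]_r g r.
Proof.
move=> f0 g0 mg fg.
rewrite [leLHS]ge0_integralTE //; apply: ge_ereal_sup => _ [h /= hf <-].
rewrite -integralT_nnsfun; apply: ae_ge0_le_integral => //.
- by move=> r _; rewrite lee_fin; exact: fun_ge0.
- by apply/measurable_EFinP; exact: measurable_funP.
- by apply: aeS fg => r fgr _; exact: le_trans (hf r) fgr.
Qed.

(** Setting [g] to 0 on a measurable null set that contains all points with [f r <> g r] keeps its
    integral and puts it below [f] everywhere. *)
Lemma ae_ge_integral_measurable (f g : R -> \bar R) :
  (forall r, 0 <= f r) -> (forall r, 0 <= g r) -> measurable_fun setT g ->
  {ae mu, forall r, f r = g r} -> \int[mu]_r g r <= \int[mu]_r f r.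
Proof.
move=> f0 g0 mg [N [mN N0 fgN]].
pose h r := if r \in N then 0 else g r.
have mh : measurable_fun setT h.
  apply: measurable_fun_ifT => //.
  apply: (@measurable_fun_bool _ _ _ _ true) => //.
  rewrite setTI (_ : _ @^-1` _ = N) //.
  by apply/seteqP; split => r /= => [/set_mem|/mem_set].
apply: (@le_trans _ _ (\int[mu]_r h r)).
  rewrite (@ge0_ae_eq_integral _ _ _ mu setT g h) //.
    by move=> r _; rewrite /h; case: ifP.
  exists N; split => // r /= /not_implyP[_] gh; apply: contrapT => rN; apply: gh.
  by rewrite /h memNset.
apply: le_integral_unmeasurable => r; rewrite /h; case: ifPn => // /negP rN.
by rewrite (_ : f r = g r) //; apply: contrapT => /fgN /mem_set.
Qed.

End UnmeasurableIntegrands.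

(** * Translation invariance of Lebesgue measure and of integrals *)

Section Translation.
Context {R : realType}.
Local Notation mu := (@lebesgue_measure R).

Lemma measurable_translation (a : R) :
  measurable_fun setT ((fun r => r + a) : R -> measurableTypeR R).
Proof. exact: measurable_funD. Qed.

(** The pushforward under the translation agrees with [mu] on half-open intervals, which determine
    the measure. *)
Lemma lebesgue_measure_translation (a : R) (A : set R) :
  measurable A -> mu ((fun r => r + a) @^-1` A) = mu A.
Proof.
move=> mA; apply/esym.
apply: (@lebesgue_measure_unique R
  (pushforward mu ((fun r => r + a) : R -> measurableTypeR R))) => //.
  exact: measurable_translation.
move=> mt _ [[x y]] _ <-; transitivity (mu `]x - a, y - a]%classic).
  rewrite !lebesgue_measure_itv /= !lte_fin ltrD2r -!EFinD.
  by rewrite opprB addrA subrK.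
rewrite /pushforward; congr (mu _).
by apply/seteqP; split => r /=; rewrite !in_itv /= ltrBlDr lerBrDr.
Qed.

Lemma measurable_translation_preimage (a : R) (A : set R) :
  measurable A -> measurable ((fun r => r + a) @^-1` A).
Proof.
by move=> mA; rewrite -[X in measurable X]setTI; exact: measurable_translation.
Qed.

Lemma ae_translation (a : R) (P : R -> Prop) :
  {ae mu, forall r, P r} -> {ae mu, forall r, P (r + a)}.
Proof.
move=> [N [mN N0 PN]]; exists ((fun r => r + a) @^-1` N); split.
- exact: measurable_translation_preimage.
- by rewrite -N0; exact: lebesgue_measure_translation.
- by move=> r /= nP; exact: PN.
Qed.

Lemma ge0_integral_translation (a : R) (g : R -> \bar R) :
  measurable_fun setT g -> (forall r, 0 <= g r)%E ->
  (\int[mu]_r g (r + a)%R = \int[mu]_r g r)%E.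
Proof.
move=> mg g0.
have <- := @ge0_integral_pushforward _ _ (measurableTypeR R) (measurableTypeR R)
  R _ (measurable_translation a) mu setT g measurableT mg (fun r _ => g0 r).
apply: eq_measure_integral => [|mt A mA _]; first exact: measurable_translation.
exact: lebesgue_measure_translation.
Qed.

Lemma simple_translation (W : Type) (a : R) (f : R -> W) :
  simple f -> simple (fun r => f (r + a)).
Proof.
move=> [finf mf]; split=> [|B].
  by apply: sub_finite_set finf => _ [r _ <-]; exists (r + a).
exact: measurable_translation_preimage (mf B).
Qed.

Lemma isimple_translation (K : scalarField R) (V : normedModType K) (a : R)
  (f : R -> V) : isimple f -> isimple (fun r => f (r + a)).
Proof.
move=> [sf ff]; split=> [|v v0]; first exact: simple_translation.
have [_ mf] := sf.
by rewrite (lebesgue_measure_translation a (mf [set v])) ff.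
Qed.

Lemma sint_translation (K : scalarField R) (V : normedModType K) (a : R)
  (f : R -> V) : simple f -> sint (fun r => f (r + a)) = sint f.
Proof.
move=> [_ mf]; rewrite /sint.
have -> : range (fun r => f (r + a)) = range f.
  apply/seteqP; split => _ [r _ <-]; first by exists (r + a).
  by exists (r - a); rewrite // subrK.
apply: eq_fsbigr => v _.
by rewrite (lebesgue_measure_translation a (mf [set v])).
Qed.

End Translation.

(** * Strong measurability and Bochner integrals *)

Section StrongMeasurability.
Context {R : realType} {K : scalarField R}.
Local Notation mu := (@lebesgue_measure R).
Implicit Types V W : normedModType K.

Definition restr V (D : set R) (f : R -> V) (r : R) : V :=
  if r \in D then f r else 0.

Definition strongly_measurableT V (f : R -> V) :=
  exists2 s : nat -> R -> V, forall n, simple (s n) &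
    {ae mu, forall r, s n r @[n --> \oo] --> f r}.

Lemma simple_restr V (D : set R) (f : R -> V) :
  measurable D -> simple f -> simple (restr D f).
Proof.
move=> mD sf.
exact: (simple_comp (fun z => if z.1 then z.2 else 0)
  (simple_pair (simple_mem mD) sf)).
Qed.

Lemma strongly_measurableT_continuous V W (f : R -> V) (phi : V -> W) :
  continuous phi -> strongly_measurableT f -> strongly_measurableT (phi \o f).
Proof.
move=> cphi [s ss sf]; exists (fun n => phi \o s n).
  by move=> n; exact: simple_comp.
apply: aeS sf => r sfr; apply: (cvg_comp (fun n => s n r) phi sfr); exact: cphi.
Qed.

Lemma strongly_measurableTD V (f g : R -> V) : strongly_measurableT f ->
  strongly_measurableT g -> strongly_measurableT (fun r => f r + g r).
Proof.
move=> [s ss sf] [s' ss' s'g]; exists (fun n r => s n r + s' n r).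
  move=> n; exact: (simple_comp (fun z => z.1 + z.2) (simple_pair (ss n) (ss' n))).
by apply: aeS (aeI sf s'g) => r [sfr s'gr]; exact: cvgD.
Qed.

Lemma strongly_measurableT_translation V (a : R) (f : R -> V) :
  strongly_measurableT f -> strongly_measurableT (fun r => f (r + a)).
Proof.
move=> [s ss sf]; exists (fun n r => s n (r + a)).
  by move=> n; exact: simple_translation.
exact: (ae_translation a sf).
Qed.

Lemma ae_eq_strongly_measurableT V (f g : R -> V) :
  {ae mu, forall r, f r = g r} -> strongly_measurableT f ->
  strongly_measurableT g.
Proof.
move=> fg [s ss sf]; exists s => //.
by apply: aeS (aeI fg sf) => r [<-].
Qed.

Lemma strongly_measurableT_restr V (D : set R) (f : R -> V) : measurable D ->
  strongly_measurableT f -> strongly_measurableT (restr D f).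
Proof.
move=> mD [s ss sf]; exists (fun n => restr D (s n)).
  by move=> n; exact: simple_restr.
apply: aeS sf => r sfr; rewrite /restr; case: ifP => // _; exact: cvg_cst.
Qed.

Lemma strongly_measurableP V (D : set R) (f : R -> V) : measurable D ->
  strongly_measurable D f <-> strongly_measurableT (restr D f).
Proof.
move=> mD; split=> [[s ss sf]|[s ss sf]].
  exists (fun n => restr D (s n)) => [n|].
    by apply: simple_restr => //; apply: simpleP => //; exact: ss.
  apply: aeS sf => r sfr; rewrite /restr; case: ifP => [/set_mem//|_].
  exact: cvg_cst.
have fs n : s n \in fimfun by apply: mem_set; exact: (ss n).1.
exists (fun n => fimfun_Sub (fs n)).
  by move=> n v; exact: (ss n).2.
by apply: aeS sf => r; rewrite /restr => + Dr; rewrite mem_set.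
Qed.

(* [f] itself need not be Borel measurable, but [rnorm \o f] agrees almost
   everywhere with a Borel function. *)
Lemma strongly_measurableT_rnorm V (f s : R -> V) :
  strongly_measurableT f -> simple s ->
  exists g : R -> R, [/\ measurable_fun setT g, forall r, 0 <= g r &
    {ae mu, forall r, rnorm (f r - s r) = g r}].
Proof.
move=> [u su [N [mN N0 uN]]] ss.
have mNC : measurable (~` N) by exact: measurableC.
(* Zeroing on the null set [N] makes the convergence hold at every point, so this is a pointwise
   limit of Borel functions. *)
exists (fun r => rnorm (restr (~` N) (fun r => f r - s r) r)); split.
- apply: (@measurable_fun_cvg _ _ _ _
    (fun n r => rnorm (restr (~` N) (fun r => u n r - s r) r))).
    move=> n; apply: simple_rnorm_measurable; apply: (simple_restr mNC).
    exact: (simple_comp (fun z => z.1 - z.2) (simple_pair (su n) ss)).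
  move=> r _; apply: cvg_rnorm; rewrite /restr; case: ifPn => [/set_mem|] rN.
    apply: cvgB; last exact: cvg_cst.
    by apply: contrapT => /uN.
  exact: cvg_cst.
- by move=> r; exact: rnorm_ge0.
- exists N; split => // r /=; rewrite /restr; apply: contra_notP => rN.
  by rewrite mem_set.
Qed.

End StrongMeasurability.

(** * The Bochner integral on the line: uniqueness, linearity, translation *)

Section Integral.
Context {R : realType} {K : scalarField R}.
Local Notation mu := (@lebesgue_measure R).
Implicit Types V W : normedModType K.

(* The measurable majorants [g n] make the definition robust: the functions
   [rnorm (f r - s n r)] themselves need not be Borel measurable. *)
Definition simple_approx V (f : R -> V) (s : nat -> R -> V)
    (g : nat -> R -> \bar R) :=
  [/\ forall n, isimple (s n), forall n, measurable_fun setT (g n),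
      forall n r, (0 <= g n r)%E,
      forall n, {ae mu, forall r, ((rnorm (f r - s n r))%:E <= g n r)%E} &
      (\int[mu]_r g n r)%E @[n --> \oo] --> 0%E].

Definition has_integral V (f : R -> V) (x : V) :=
  strongly_measurableT f /\
  exists s g, simple_approx f s g /\ sint (s n) @[n --> \oo] --> x.

Lemma cvge0_near_lt (u : nat -> \bar R) (e : R) : 0 < e ->
  u n @[n --> \oo] --> 0%E -> \forall n \near \oo, (u n < e%:E)%E.
Proof.
move=> e0 u0; apply: (u0 [set y | (y < e%:E)%E]).
by apply: open_nbhs_nbhs; split; [exact: open_ereal_lt_ereal|rewrite /= lte_fin].
Qed.

Lemma ge0_integralDT (f g : R -> \bar R) : measurable_fun setT f ->
  measurable_fun setT g -> (forall r, 0 <= f r)%E -> (forall r, 0 <= g r)%E ->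
  (\int[mu]_r (f r + g r) = \int[mu]_r f r + \int[mu]_r g r)%E.
Proof. by move=> mf mg f0 g0; apply: ge0_integralD. Qed.

(** The two simple integrals differ by at most the integral of [g n + g' n], which tends to 0.
    Besides uniqueness, this allows approximants to be replaced by their restrictions to a set. *)
Lemma simple_approx_sint_cvg V (f : R -> V) s g s' g' (x : V) :
  simple_approx f s g -> simple_approx f s' g' ->
  sint (s n) @[n --> \oo] --> x -> sint (s' n) @[n --> \oo] --> x.
Proof.
move=> [is_ mg g0 fg gto0] [is' mg' g'0 fg' g'to0] /cvg_rnormP sx.
apply/cvg_rnormP => e e0.
have e20 : 0 < e / 2 by rewrite divr_gt0.
have gg'0 : (\int[mu]_r g n r + \int[mu]_r g' n r)%E @[n --> \oo] --> 0%E.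
  by rewrite -(adde0 0%E); apply: cvgeD.
near=> n.
have h1 : rnorm (sint (s n) - x) < e / 2 by near: n; exact: sx.
have h2 : ((\int[mu]_r g n r + \int[mu]_r g' n r) < (e / 2)%:E)%E.
  by near: n; exact: cvge0_near_lt.
have h3 : rnorm (sint (s' n) - sint (s n)) < e / 2.
  rewrite -lte_fin; apply: le_lt_trans h2.
  rewrite -sintB //; apply: le_trans (rnorm_sint_le _) _; first exact: isimpleB.
  rewrite -ge0_integralDT //; apply: ae_le_integral_measurable.
  - by move=> r; rewrite lee_fin rnorm_ge0.
  - by move=> r; exact: adde_ge0.
  - exact: emeasurable_funD.
  - apply: aeS (aeI (fg n) (fg' n)) => r [h h'].
    apply: le_trans (leeD h h'); rewrite -EFinD lee_fin.
    rewrite (_ : s' n r - s n r = (f r - s n r) - (f r - s' n r)).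
      by apply: le_trans (rnormD _ _) _; rewrite rnormN.
    by rewrite opprB [RHS]addrC addrA subrK.
rewrite -(subrK (sint (s n)) (sint (s' n))) -addrA.
by apply: le_lt_trans (rnormD _ _) _; rewrite (splitr e) ltrD.
Unshelve. all: by end_near. Qed.

Lemma has_integral_unique V (f : R -> V) (x y : V) :
  has_integral f x -> has_integral f y -> x = y.
Proof.
move=> [_ [s [g [sg sx]]]] [_ [s' [g' [sg' s'y]]]].
exact: cvg_unique (simple_approx_sint_cvg sg sg' sx) s'y.
Qed.

(** An operator bound [C] for [L] turns the majorants [g n] into [C * g n], and [L] commutes with
    [sint]. It serves for [T b] and for the operator that changes [lambda]. *)
Lemma has_integral_linear V W (f : R -> V) (x : V) (L : {linear V -> W}) :
  continuous L -> has_integral f x -> has_integral (L \o f) (L x).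
Proof.
move=> cL [mf [s [g [[is_ mg g0 fg gto0] sx]]]].
have [C C0 LC] := continuous_linear_rnorm cL.
split; first exact: strongly_measurableT_continuous.
exists (fun n => L \o s n), (fun n r => C%:E * g n r)%E; split; last first.
  rewrite (_ : (fun n => sint (L \o s n)) = (fun n => L (sint (s n)))).
    exact: (cvg_comp (fun n => sint (s n)) L sx (cL x)).
  by apply/funext => n; rewrite sint_linear.
split.
- by move=> n; exact: isimple_comp (linear0 L) (is_ n).
- by move=> n; exact: measurable_funeM.
- by move=> n r; rewrite mule_ge0.
- move=> n; apply: aeS (fg n) => r fgr /=; rewrite -linearB.
  apply: (@le_trans _ _ (C%:E * (rnorm (f r - s n r))%:E)%E).
    by rewrite -EFinM lee_fin LC.
  by rewrite lee_wpmul2l.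
- rewrite (_ : (fun n => _) = (fun n => C%:E * \int[mu]_r g n r)%E).
    by rewrite -(mule0 C%:E); apply: cvgeZl.
  by apply/funext => n; rewrite ge0_integralZl_EFin //; exact: mg.
Qed.

Lemma has_integralD V (f f' : R -> V) (x x' : V) : has_integral f x ->
  has_integral f' x' -> has_integral (fun r => f r + f' r) (x + x').
Proof.
move=> [mf [s [g [[is_ mg g0 fg gto0] sx]]]].
move=> [mf' [s' [g' [[is' mg' g'0 fg' g'to0] sx']]]].
split; first exact: strongly_measurableTD.
exists (fun n r => s n r + s' n r), (fun n r => g n r + g' n r)%E; split; last first.
  under eq_fun do rewrite sintD //.
  exact: cvgD.
split.
- by move=> n; exact: isimpleD.
- by move=> n; exact: emeasurable_funD.
- by move=> n r; exact: adde_ge0.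
- move=> n; apply: aeS (aeI (fg n) (fg' n)) => r [h h'].
  apply: le_trans (leeD h h'); rewrite -EFinD lee_fin.
  by rewrite opprD addrACA; exact: rnormD.
- under eq_fun do rewrite ge0_integralDT //.
  by rewrite -(adde0 0%E); apply: cvgeD.
Qed.

Lemma has_integral_translation V (a : R) (f : R -> V) (x : V) :
  has_integral f x -> has_integral (fun r => f (r + a)) x.
Proof.
move=> [mf [s [g [[is_ mg g0 fg gto0] sx]]]].
split; first exact: strongly_measurableT_translation.
exists (fun n r => s n (r + a)), (fun n r => g n (r + a)); split; last first.
  under eq_fun do rewrite (sint_translation a (is_ _).1).
  exact: sx.
split=> //.
- by move=> n; exact: isimple_translation.
- by move=> n; apply: measurableT_comp (mg n) (measurable_translation a).
- by move=> n; exact: (ae_translation a (fg n)).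
- by under eq_fun do rewrite ge0_integral_translation //.
Qed.

Lemma ae_eq_has_integral V (f f' : R -> V) (x : V) :
  {ae mu, forall r, f r = f' r} -> has_integral f x -> has_integral f' x.
Proof.
move=> ff' [mf [s [g [[is_ mg g0 fg gto0] sx]]]].
split; first exact: ae_eq_strongly_measurableT mf.
exists s, g; split => //; split => // n.
by apply: aeS (aeI ff' (fg n)) => r [<-].
Qed.

Lemma simple_integral_restr V (D : set R) (s : {fimfun R >-> V}) :
  measurable D -> simple_integral D s = sint (restr D s).
Proof.
(* A common index set: the two ranges may differ by 0 and by values that [s] takes only outside [D].
   The extra terms vanish, since [v = 0] or the fibre is empty. *)
move=> mD; pose S := range s `|` [set 0].
have E v : v != 0 -> restr D s @^-1` [set v] = D `&` s @^-1` [set v].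
  move=> v0; apply/seteqP; split => r /=; rewrite /restr.
    case: ifP => [/set_mem//|_ v0']; by rewrite v0' eqxx in v0.
  by move=> [/mem_set ->].
rewrite /simple_integral /sint (fsbig_widen _ S); last 2 first.
- by move=> v; left.
- by move=> v [[|->] //= _]; rewrite scaler0.
rewrite [RHS](fsbig_widen _ S); last 2 first.
- move=> _ [r _ <-]; rewrite /restr; case: ifP => _; last by right.
  by left; exists r.
- move=> v [_ /= vs]; have [->|v0] := eqVneq v 0; first by rewrite scaler0.
  rewrite [X in mu X](_ : _ = set0) ?measure0 ?scale0r //= ?rmorph0 ?scale0r //.
  by rewrite -subset0 => r /= rv; apply: vs; exists r.
apply: eq_fsbigr => v _; have [->|v0] := eqVneq v 0; first by rewrite !scaler0.
by rewrite E.
Qed.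

Lemma rnorm_restrB V (D : set R) (f s : R -> V) (r : R) :
  rnorm (restr D f r - restr D s r) = rnorm (restr D (fun r => f r - s r) r).
Proof. by rewrite /restr; case: ifP => // _; rewrite subrr. Qed.

(** Forward, the majorants are Borel functions equal a.e. to the norms, so their integrals do not
    exceed those of the norms. Backward, the norms are squeezed below the given majorants. *)
Lemma is_bochner_integralP V (D : set R) (f : R -> V) (x : V) : measurable D ->
  is_bochner_integral D f x <-> has_integral (restr D f) x.
Proof.
move=> mD.
have intE (s : R -> V) : (\int[mu]_(r in D) (rnorm (f r - s r))%:E =
    \int[mu]_r (rnorm (restr D f r - restr D s r))%:E)%E.
  rewrite integral_mkcond; apply: eq_integral => r _.
  by rewrite rnorm_restrB /patch /restr; case: ifP => // _; rewrite rnorm0.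
split=> [[/(strongly_measurableP _ mD) mf [s [is_ fs sx]]]|[mf [s [g [sg sx]]]]].
  split => //.
  have isr n : isimple (restr D (s n)).
    have [ms ms0] := is_ n; split=> [|v v0].
      by apply: simple_restr => //; exact: simpleP.
    apply: le_lt_trans (ms0 v v0); apply: le_measure; rewrite ?inE.
    - have /(simple_restr mD)[_] : simple (s n) by exact: simpleP.
      by apply.
    - by apply: measurableI => //; exact: ms.
    - move=> r /=; rewrite /restr; case: ifP => [/set_mem//|_ v0'].
      by rewrite v0' eqxx in v0.
  have /choice[g gP] : forall n, exists g : R -> R, [/\ measurable_fun setT g,
      forall r, 0 <= g r &
      {ae mu, forall r, rnorm (restr D f r - restr D (s n) r) = g r}].
    by move=> n; apply: strongly_measurableT_rnorm => //; exact: (isr n).1.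
  exists (fun n => restr D (s n)), (fun n r => (g n r)%:E); split; last first.
    by under eq_fun do rewrite -simple_integral_restr //.
  have mg n : measurable_fun setT (fun r => (g n r)%:E).
    by apply/measurable_EFinP; have [] := gP n.
  split=> //.
  - by move=> n r; rewrite lee_fin; have [_ + _] := gP n; exact.
  - by move=> n; have [_ _] := gP n; apply: aeS => r ->.
  - apply: (squeeze_cvge _ (cvg_cst 0%E) fs); apply: nearW => n.
    have [_ gn0 gnE] := gP n.
    rewrite integral_ge0 /=; last by move=> r _; rewrite lee_fin.
    rewrite intE; apply: ae_ge_integral_measurable => //.
    + by move=> r; rewrite lee_fin rnorm_ge0.
    + by apply: aeS gnE => r hr; rewrite hr.
split; first exact/(strongly_measurableP _ mD).
have [is_ mg g0 fg gto0] := sg.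
have fs n : s n \in fimfun by apply: mem_set; exact: (is_ n).1.1.
have isr n : isimple (restr D (s n)).
  have [ss ms0] := is_ n; split=> [|v v0]; first exact: simple_restr.
  apply: le_lt_trans (ms0 v v0); apply: le_measure; rewrite ?inE.
  - by have [_] := simple_restr mD ss; apply.
  - by case: ss => _; apply.
  - move=> r /=; rewrite /restr; case: ifP => // _ v0'.
    by rewrite v0' eqxx in v0.
have fg' n : {ae mu, forall r,
    ((rnorm (restr D f r - restr D (s n) r))%:E <= g n r)%E}.
  apply: aeS (fg n) => r; rewrite rnorm_restrB /restr; case: ifP => // _ _.
  by rewrite rnorm0.
(* [simple_integral D (s n)] is [sint] of the restricted function, so its limit has to be carried
   over from the sequence [s] to its restrictions. *)
have sg' : simple_approx (restr D f) (fun n => restr D (s n)) g by split.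
exists (fun n => fimfun_Sub (fs n)); split.
- move=> n; have [ss ms0] := is_ n; split=> [v|v v0]; first exact: ss.2.
  apply: le_lt_trans (ms0 v v0); apply: le_measure; rewrite ?inE.
  + by apply: measurableI => //; exact: ss.2.
  + exact: ss.2.
  + by move=> r [].
- apply: (squeeze_cvge _ (cvg_cst 0%E) gto0); apply: nearW => n.
  rewrite integral_ge0 /=; last by move=> r _; rewrite lee_fin rnorm_ge0.
  rewrite intE; apply: ae_le_integral_measurable => // r.
  by rewrite lee_fin rnorm_ge0.
- under eq_fun do rewrite simple_integral_restr //.
  exact: simple_approx_sint_cvg sg sg' sx.
Qed.

Lemma bochner_integralE V (D : set R) (f : R -> V) (x : V) : measurable D ->
  is_bochner_integral D f x -> bochner_integral D f = x.
Proof.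
move=> mD fx; rewrite /bochner_integral.
case: xgetP => [y _ /= /(is_bochner_integralP _ _ mD) fy|/(_ x)//].
by apply: has_integral_unique fy _; exact/is_bochner_integralP.
Qed.

End Integral.

(** * Restriction and concatenation of L^p controls *)

Section LpFunctions.
Context {R : realType} {K : scalarField R} {V : normedModType K}.
Local Notation mu := (@lebesgue_measure R).
Implicit Types (p : \bar R) (u w : R -> V).

(** Finiteness of the L^p norm without its value: a Borel majorant of the power is enough, so [h]
    itself need not be Borel. *)
Definition pdominated (p : \bar R) (h : R -> R) : Prop :=
  match p with
  | q%:E => exists g : R -> \bar R, [/\ measurable_fun setT g,
      forall r, (0 <= g r)%E, {ae mu, forall r, ((h r `^ q)%:E <= g r)%E} &
      (\int[mu]_r g r < +oo)%E]
  | +oo%E => exists C : R, {ae mu, forall r, h r <= C}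
  | -oo%E => False
  end.

(** For [p = +oo] the norm is the essential supremum only if the whole space has positive measure;
    this selects that branch. *)
Lemma lebesgue_measureT_gt0 : (0 < mu setT)%E.
Proof.
apply: (@lt_le_trans _ _ (mu `[0, 1])); last by apply: le_measure; rewrite ?inE.
by rewrite lebesgue_measure_itv /= lte_fin ltr01 -EFinD subr0 lte_fin.
Qed.

Lemma LpP p (t : R) u : (1 <= p)%E -> Lp p t u <->
  strongly_measurableT (restr `[0, t] u) /\
  pdominated p (fun r => rnorm (restr `[0, t] u r)).
Proof.
have mD : measurable (`[0, t] : set R) by [].
have normE (r : R) : `|((fun s => (rnorm (u s))%:E) \_ `[0%R, t]) r|%E =
    (rnorm (restr `[0, t] u r))%:E.
  rewrite /patch /restr; case: ifP => _; last by rewrite rnorm0 abse0.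
  by rewrite abse_EFin ger0_norm ?rnorm_ge0.
move=> p1; rewrite /Lp /=.
split=> [[/(strongly_measurableP _ mD) mu_ Nu]|[mu_ du]].
  split => //; move: p p1 Nu => [q| |] //= q1.
    rewrite unlock.
    have q0 : q^-1 != 0.
      by rewrite invr_eq0 gt_eqF // (lt_le_trans ltr01) // -lee_fin.
    move=> /(lty_poweRy q0) intu.
    (* With the zero function subtracted, this gives a Borel function equal a.e. to the norm of the
       control; its power is the majorant. *)
    have [g [mg g0 gE]] := strongly_measurableT_rnorm mu_ (simple_cst 0).
    exists (fun r => (g r `^ q)%:E); split.
    + by apply/measurable_EFinP; exact: measurableT_comp (measurable_powR q) mg.
    + by move=> r; rewrite lee_fin powR_ge0.
    + by apply: aeS gE => r; rewrite subr0 => ->.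
    + apply: le_lt_trans intu; apply: ae_ge_integral_measurable.
      * by move=> r; exact: poweR_ge0.
      * by move=> r; rewrite lee_fin powR_ge0.
      * by apply/measurable_EFinP; exact: measurableT_comp (measurable_powR q) mg.
      * apply: aeS gE => r; rewrite subr0 => gr.
        by rewrite normE poweR_EFin gr.
  rewrite unlock lebesgue_measureT_gt0 /= => /ereal_inf_lt[y /= uy yoo].
  move: y uy yoo => [C| |] //= uC _.
    exists C; apply: aeS uC => r /=.
    by rewrite normE lee_fin.
  (* The bound [-oo] holds at no point, so any constant would serve. *)
  exists 0; apply: aeS uC => r /=.
  by rewrite normE leeNy_eq.
split; first exact/(strongly_measurableP _ mD).
move: p p1 du => [q| |] //= q1; rewrite unlock.
  move=> [g [mg g0 ug gfin]]; apply: poweR_lty; apply: le_lt_trans gfin.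
  apply: ae_le_integral_measurable => //.
    by move=> r; exact: poweR_ge0.
  by apply: aeS ug => r; rewrite normE poweR_EFin.
move=> [C uC]; case: ifP => // _.
apply: (@le_lt_trans _ _ C%:E); last exact: ltry.
by apply: ereal_inf_lbound => /=; apply: aeS uC => r; rewrite normE lee_fin.
Qed.


(** Stands in for Minkowski's inequality: a concatenation has at almost every point the norm of one
    of its pieces, so its power lies below the sum of the two majorants. With [h1 = h2] it is
    monotonicity. *)
Lemma pdominated_or p (h h1 h2 : R -> R) : (1 <= p)%E ->
  (forall r, 0 <= h r) -> {ae mu, forall r, h r <= h1 r \/ h r <= h2 r} ->
  pdominated p h1 -> pdominated p h2 -> pdominated p h.
Proof.
case: p => [q| |] //= q1 h0 h12; last first.
  move=> [C1 C1h] [C2 C2h]; exists (Num.max C1 C2).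
  apply: aeS (aeI h12 (aeI C1h C2h)) => r [[hr|hr] [hC1 hC2]]; rewrite le_max.
    by rewrite (le_trans hr hC1).
  by rewrite (le_trans hr hC2) orbT.
move=> [g1 [mg1 g10 hg1 g1fin]] [g2 [mg2 g20 hg2 g2fin]].
have q0 : 0 <= q by rewrite (le_trans ler01) // -lee_fin.
exists (fun r => g1 r + g2 r)%E; split.
- exact: emeasurable_funD.
- by move=> r; exact: adde_ge0.
- apply: aeS (aeI h12 (aeI hg1 hg2)) => r [hr [hgr1 hgr2]].
  have pow (x : R) : h r <= x -> ((h r `^ q)%:E <= (x `^ q)%:E)%E.
    move=> hx; rewrite lee_fin ge0_ler_powR // nnegrE //; exact: le_trans hx.
  case: hr => /pow hr.
    by apply: le_trans hr _; apply: le_trans hgr1 _; rewrite leeDl.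
  by apply: le_trans hr _; apply: le_trans hgr2 _; rewrite leeDr.
- by rewrite ge0_integralDT // lte_add_pinfty.
Qed.

Lemma pdominated_translation p (a : R) (h : R -> R) :
  pdominated p h -> pdominated p (fun r => h (r + a)).
Proof.
case: p => [q| |] //=; last first.
  by move=> [C hC]; exists C; exact: (ae_translation (P := fun r => h r <= C) a hC).
move=> [g [mg g0 hg gfin]]; exists (fun r => g (r + a)); split=> //.
- exact: measurableT_comp mg (measurable_translation a).
- exact: (ae_translation (P := fun r => ((h r `^ q)%:E <= g r)%E) a hg).
- by rewrite ge0_integral_translation.
Qed.

Lemma Lp0 p (t : R) : (1 <= p)%E -> Lp p t (fun _ : R => 0 : V).
Proof.
move=> p1; apply/LpP => //.
have rE r : restr `[0, t] (fun _ => 0 : V) r = 0 by rewrite /restr; case: ifP.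
split.
  exists (fun _ _ => 0) => [n|]; first exact: simple_cst.
  by apply: aeW => r; rewrite rE; exact: cvg_cst.
case: p p1 => [q| |] //= q1; last by exists 0; apply: aeW => r; rewrite rE rnorm0.
exists (fun=> 0%E); split => //; last by rewrite integral0 ltry.
by apply: aeW => r; rewrite rE rnorm0 powR0 // gt_eqF // (lt_le_trans ltr01) //.
Qed.

Lemma rnorm_restr_le (D : set R) u (r : R) : rnorm (restr D u r) <= rnorm (u r).
Proof. by rewrite /restr; case: ifP => // _; rewrite rnorm0 rnorm_ge0. Qed.

Lemma Lp_head p (a b : R) u : (1 <= p)%E -> 0 <= b ->
  Lp p (a + b) u -> Lp p a u.
Proof.
move=> p1 b0 /(LpP _ _ p1) [mu_ du]; apply/LpP => //.
have rE r : restr `[0, a] u r = restr `[0, a] (restr `[0, a + b] u) r.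
  rewrite /restr; case: ifP => // /set_mem /=; rewrite in_itv /= => /andP[r0 ra].
  by rewrite mem_set //= in_itv /= r0 (le_trans ra) // lerDl.
split.
  by rewrite (funext rE); exact: strongly_measurableT_restr.
apply: (pdominated_or p1 _ _ du du) => [r|]; first exact: rnorm_ge0.
apply: aeW => r; left; rewrite rE; exact: rnorm_restr_le.
Qed.

Lemma Lp_tail p (a b : R) u : (1 <= p)%E -> 0 <= a ->
  Lp p (a + b) u -> Lp p b (fun s => u (s + a)).
Proof.
move=> p1 a0 /(LpP _ _ p1) [mu_ du]; apply/LpP => //.
have rE r : restr `[0, b] (fun s => u (s + a)) r =
    restr `[0, b] (fun s => restr `[0, a + b] u (s + a)) r.
  rewrite /restr; case: ifP => // /set_mem /=; rewrite in_itv /= => /andP[r0 rb].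
  by rewrite mem_set //= in_itv /= addr_ge0 //= addrC lerD2l.
have du' := pdominated_translation a du.
split.
  rewrite (funext rE); apply: strongly_measurableT_restr => //.
  exact: strongly_measurableT_translation.
apply: (pdominated_or p1 _ _ du' du') => [r|]; first exact: rnorm_ge0.
apply: aeW => r; left; rewrite rE.
exact: (rnorm_restr_le _ (fun s => restr `[0, a + b] u (s + a))).
Qed.

Lemma ae_neq (a : R) (P : R -> Prop) :
  (forall r, r != a -> P r) -> {ae mu, forall r, P r}.
Proof.
move=> Pa; exists [set a]; split; [exact: measurable_set1| |].
- exact: lebesgue_measure_set1.
- by move=> r /= nP; apply: contra_notP nP => /eqP; exact: Pa.
Qed.

Definition concatenation (a : R) u w (s : R) : V :=
  if s <= a then u s else w (s - a).

(** At [r = a] both closed intervals contribute to the right side, hence the exclusion of that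
    point, which is a null set. *)
Lemma restr_concatenation (a b : R) u w (r : R) : 0 <= a -> 0 <= b -> r != a ->
  restr `[0, a + b] (concatenation a u w) r =
  restr `[0, a] u r + restr `[0, b] w (r - a).
Proof.
move=> a0 b0 ra; rewrite /restr /concatenation.
have memE (x c : R) : (x \in `[0, c]%classic) = (0 <= x <= c).
  by apply/idP/idP => [/set_mem|h]; [rewrite /= in_itv|apply: mem_set; rewrite /= in_itv].
rewrite !memE subr_ge0 lerBlDl.
case: (ltgtP r a) ra => // ra _.
  have -> : r <= a + b by rewrite (le_trans (ltW ra)) // lerDl.
  by rewrite andbT addr0.
by rewrite (ltW (le_lt_trans a0 ra)) /= add0r.
Qed.

Lemma Lp_concatenation p (a b : R) u w : (1 <= p)%E -> 0 <= a -> 0 <= b ->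
  Lp p a u -> Lp p b w -> Lp p (a + b) (concatenation a u w).
Proof.
move=> p1 a0 b0 /(LpP _ _ p1) [mu_ du] /(LpP _ _ p1) [mw dw]; apply/LpP => //.
have cE := restr_concatenation u w a0 b0.
split.
  apply: (ae_eq_strongly_measurableT _ (strongly_measurableTD mu_
    (strongly_measurableT_translation (- a) mw))).
  by apply: (ae_neq (a := a)) => r ra; rewrite cE.
apply: (pdominated_or p1 _ _ du (pdominated_translation (- a) dw)).
  by move=> r; exact: rnorm_ge0.
apply: (ae_neq (a := a)) => r ra; rewrite cE //.
have [ra'|ra'] := leP r a.
  left; rewrite [X in _ + X](_ : _ = 0) ?addr0 // /restr; case: ifP => // /set_mem /=.
  by rewrite in_itv /= subr_ge0 => /andP[ar]; move: ra; rewrite eq_le ra' ar.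
right; rewrite [X in X + _](_ : _ = 0) ?add0r // /restr; case: ifP => // /set_mem /=.
by rewrite in_itv /= [r <= a]leNgt ra' andbF.
Qed.

End LpFunctions.

(** * Semigroups and boundary control *)

Section Semigroup.
Context {R : realType} {K : scalarField R} {X : normedModType K}.
Context (T : R -> {linear X -> X}) (A : partial_op X).
Context (T_semigroup : C0_semigroup T) (T_generator : generator T A).

(** [T t] maps the difference quotient at [x] to the one at [T t x], and continuity of [T t] carries
    the limit over. *)
Lemma generator_semigroup_comm (t : R) (x : X) : 0 <= t -> dom A x ->
  dom A (T t x) /\ A (T t x) = T t (A x).
Proof.
move=> t0 Ax; have [cT T0 TD _] := T_semigroup; apply/T_generator.
have := (T_generator x (A x)).1 (conj Ax erefl).
move=> /(cvg_comp _ (T t)) /(_ (cT t t0 _)).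
apply: cvg_trans; apply: near_eq_cvg; near=> h.
have h0 : 0 <= h by near: h; exact: nbhs_right_ge.
by rewrite /= linearZ linearB /= -!TD // [h + t]addrC.
Unshelve. all: by end_near. Qed.

(** Write [y] as [lambda - A] applied to [Rl y], move [T t] past [lambda - A], and cancel with
    [Rl]. *)
Lemma resolvent_semigroup_comm (lambda : K) (Rl : {linear X -> X}) (t : R) (y : X) :
  (forall y, dom A (Rl y) /\ lambda *: Rl y - A (Rl y) = y) ->
  (forall x, dom A x -> Rl (lambda *: x - A x) = x) ->
  0 <= t -> Rl (T t y) = T t (Rl y).
Proof.
move=> Rl1 Rl2 t0; have [domR RE] := Rl1 y.
have [domT TE] := generator_semigroup_comm t0 domR.
by rewrite -{1}RE linearB linearZ /= -TE Rl2.
Qed.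

End Semigroup.

(** * Dirichlet operators, transfer of admissibility, reachability spaces *)

Section Reachability.
Context {R : realType} {K : scalarField R} {X dX U : normedModType K}.
Context (Am : partial_op X) (Q : X -> dX) (B : {linear U -> dX}).
Context (T : R -> {linear X -> X}).
Context (Am_linear : linear_op Am) (Q_bounded : graph_bounded Am Q).
Context (T_semigroup : C0_semigroup T).
Context (T_generator : generator T (ker_restriction Am Q)).
Context (Q_surjective : forall v : dX, exists2 x : X, dom Am x & Q x = v).

Local Notation A := (ker_restriction Am Q).
Local Notation ci := (control_integrand Am Q B T).

Lemma dom_ker_linear (a : K) (x y : X) :
  dom A x -> dom A y -> dom A (a *: x + y) /\ Am (a *: x + y) = a *: Am x + Am y.
Proof.
have [_ linA] := Am_linear; have [linQ _] := Q_bounded.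
move=> [xA xQ] [yA yQ]; have [domxy Axy] := linA a x y xA yA.
by split => //; split => //; rewrite linQ // xQ yQ scaler0 addr0.
Qed.

(** The difference lies in the kernel of [Q], hence in [dom A], where [lambda - A] is injective. *)
Lemma dirichlet_op_unique (lambda : K) (x y : X) : resolvent_set A lambda ->
  dom Am x -> dom Am y -> lambda *: x - Am x = 0 -> lambda *: y - Am y = 0 ->
  Q x = Q y -> x = y.
Proof.
move=> [Rl [_ _ Rl2]] xA yA lx ly Qxy.
have [_ linA] := Am_linear; have [linQ _] := Q_bounded.
have [domyx Ayx] := linA (-1) y x yA xA.
have : dom A (-1 *: y + x).
  by split => //; rewrite linQ // Qxy scaleN1r addNr.
move=> /Rl2; rewrite /= Ayx !scaleN1r scalerDr scalerN opprD opprK addrACA.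
rewrite lx [- _ + _](_ : _ = - (lambda *: y - Am y)); last by rewrite opprB addrC.
by rewrite ly oppr0 addr0 linear0 => /esym/eqP; rewrite addrC subr_eq0 => /eqP.
Qed.

(** From any preimage [x0] of [v], subtract the resolvent applied to [lambda *: x0 - Am x0]: this
    removes the defect and leaves the boundary value alone. *)
Lemma dirichlet_opP (lambda : K) (v : dX) : resolvent_set A lambda ->
  let x := dirichlet_op Am Q lambda v in
  [/\ dom Am x, lambda *: x - Am x = 0 & Q x = v].
Proof.
move=> [Rl [_ Rl1 _]]; rewrite /dirichlet_op /=.
have [_ linA] := Am_linear; have [linQ _] := Q_bounded.
have [x0 x0A Qx0] := Q_surjective v.
pose y := Rl (lambda *: x0 - Am x0).
have [[yA yQ] yE] := Rl1 (lambda *: x0 - Am x0).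
have [domyx Ayx] := linA (-1) y x0 yA x0A.
case: xgetP => [x _ //|/(_ (-1 *: y + x0))[]]; split => //.
  rewrite Ayx !scaleN1r scalerDr scalerN opprD opprK addrACA.
  rewrite [- _ + _](_ : _ = - (lambda *: y - Am y)); last by rewrite opprB addrC.
  by rewrite [lambda *: y - _]yE addNr.
by rewrite linQ // yQ scaler0 add0r.
Qed.

Lemma dirichlet_op0 (lambda : K) : resolvent_set A lambda ->
  dirichlet_op Am Q lambda 0 = 0.
Proof.
move=> res; have [dA dE dQ] := dirichlet_opP 0 res.
have [dom0 linA] := Am_linear; have [linQ _] := Q_bounded.
have [_ A0] := linA (-1) 0 0 dom0 dom0; have Q0 := linQ (-1) 0 0 dom0 dom0.
rewrite !scaleN1r !addNr in A0 Q0.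
apply: (dirichlet_op_unique res) => //; last by rewrite dQ Q0.
by rewrite A0 subr0 scaler0.
Qed.

(** The right side has boundary value [v], and [lambda - Am] sends its two terms to opposite
    multiples of [dirichlet_op Am Q lambda0 v]; uniqueness concludes. *)
Lemma dirichlet_op_resolvent (lambda lambda0 : K) (Rl : {linear X -> X}) (v : dX) :
  resolvent_set A lambda -> resolvent_set A lambda0 ->
  (forall y, dom A (Rl y) /\ lambda *: Rl y - A (Rl y) = y) ->
  dirichlet_op Am Q lambda v = dirichlet_op Am Q lambda0 v +
    (lambda0 - lambda) *: Rl (dirichlet_op Am Q lambda0 v).
Proof.
move=> res res0 Rl1.
have [zA zE zQ] := dirichlet_opP v res; have [yA yE yQ] := dirichlet_opP v res0.
set y := dirichlet_op Am Q lambda0 v in yA yE yQ *.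
have [[rA rQ] rE] := Rl1 y; rewrite /= in rA rQ rE.
have [_ linA] := Am_linear; have [linQ _] := Q_bounded.
have [dA dE] := linA (lambda0 - lambda) (Rl y) y rA yA.
rewrite addrC; apply: (dirichlet_op_unique res) => //; last first.
  by rewrite linQ // zQ rQ scaler0 add0r.
rewrite dE scalerDr scalerA mulrC -scalerA opprD addrACA -scalerBr rE.
by rewrite scalerBl addrA subrK -[RHS]yE.
Qed.

Definition admissible_at (lambda : K) (p : \bar R) (t : R) :=
  forall u, Lp p t u -> exists2 x : X, dom A x &
    has_integral (restr `[0, t] (ci lambda t u)) x.

Lemma admissible_at_resolvent (lambda lambda0 : K) (p : \bar R) (t : R) :
  resolvent_set A lambda -> resolvent_set A lambda0 ->
  admissible_at lambda0 p t -> admissible_at lambda p t.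
Proof.
move=> res res0 adm u /adm[x xA intx].
have [Rl [cRl Rl1 Rl2]] := res.
(* [L] commutes with the semigroup, so it maps the integrand for [lambda0] to the one for [lambda];
   it also preserves [dom A]. *)
pose L : {linear X -> X} := idfun \+ ((lambda0 - lambda) \*: Rl).
have cL : continuous L.
  by move=> z; apply: cvgD; [exact: cvg_id|apply: cvgZr; exact: cRl].
exists (L x); first by rewrite /= addrC; apply: (dom_ker_linear _ (Rl1 x).1 xA).1.
have := has_integral_linear cL intx.
congr (has_integral _ _); apply/funext => r; rewrite /restr /=.
case: ifP => [/set_mem /=|]; last by rewrite linear0 scaler0 addr0.
rewrite in_itv /= => /andP[_ rt]; rewrite /control_integrand.
rewrite (dirichlet_op_resolvent _ res res0 Rl1) linearD linearZ /=.
by rewrite (resolvent_semigroup_comm T_semigroup T_generator _ Rl1 Rl2) // subr_ge0.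
Qed.

(** A delayed control has the same remaining time [b - r], so the integral is unchanged. Zeros
    appended on the right would give [T a x] instead, and its membership in [dom A] says nothing
    about [x]. *)
Lemma admissible_at_tail (lambda : K) (p : \bar R) (a b : R) :
  resolvent_set A lambda -> (1 <= p)%E -> 0 <= a -> 0 <= b ->
  admissible_at lambda p (a + b) -> admissible_at lambda p b.
Proof.
move=> res p1 a0 b0 adm u uLp.
have [x xA intx] := adm _ (Lp_concatenation p1 a0 b0 (Lp0 a p1) uLp).
exists x => //; have := has_integral_translation a intx.
apply: ae_eq_has_integral; apply: (ae_neq (a := 0)) => r r0.
rewrite (_ : restr _ _ _ = restr `[0, a + b]
    (concatenation a (fun=> 0) (ci lambda b u)) (r + a)).
  rewrite restr_concatenation ?addrK //; last by rewrite -subr_eq0 addrK.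
  by rewrite [X in X + _](_ : _ = 0) ?add0r // /restr; case: ifP.
rewrite /restr; case: ifP => // _; rewrite /control_integrand /concatenation.
case: ifP => _; first by rewrite linear0 dirichlet_op0 // linear0.
by rewrite addrK; congr (T _ _); ring.
Qed.

Lemma control_integralD (lambda : K) (a b : R) (u : R -> U) (x y : X) :
  0 <= a -> 0 <= b ->
  has_integral (restr `[0, a] (ci lambda a u)) x ->
  has_integral (restr `[0, b] (ci lambda b (fun s => u (s + a)))) y ->
  has_integral (restr `[0, a + b] (ci lambda (a + b) u)) (T b x + y).
Proof.
move=> a0 b0 intx inty; have [cT _ TD _] := T_semigroup.
apply: (ae_eq_has_integral _ (has_integralD
  (has_integral_linear (cT b b0) intx) (has_integral_translation (- a) inty))).
apply: (ae_neq (a := a)) => r ra.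
rewrite (_ : restr `[0, a + b] _ r = restr `[0, a + b]
  (concatenation a (T b \o ci lambda a u) (ci lambda b (fun s => u (s + a)))) r).
  rewrite restr_concatenation //; congr (_ + _).
  by rewrite /restr /=; case: ifP => // _; rewrite linear0.
rewrite /restr; case: ifP => // /set_mem /=; rewrite in_itv /= => /andP[_ rab].
rewrite /control_integrand /concatenation /=; case: ifP => ra'.
  by rewrite -TD ?subr_ge0 // addrA [b + a]addrC.
by rewrite subrK opprB addrCA addrA.
Qed.

Lemma admissible_atD (lambda : K) (p : \bar R) (a b : R) :
  (1 <= p)%E -> 0 <= a -> 0 <= b ->
  admissible_at lambda p a -> admissible_at lambda p b ->
  admissible_at lambda p (a + b).
Proof.
move=> p1 a0 b0 adma admb u uLp.
have [x xA intx] := adma _ (Lp_head p1 b0 uLp).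
have [y yA inty] := admb _ (Lp_tail p1 a0 uLp).
exists (T b x + y); last exact: control_integralD.
have [TxA _] := generator_semigroup_comm T_semigroup T_generator b0 xA.
by have := (dom_ker_linear 1 TxA yA).1; rewrite scale1r.
Qed.

Lemma admissible_at_all (lambda : K) (p : \bar R) (t0 t : R) :
  resolvent_set A lambda -> (1 <= p)%E -> 0 < t0 -> 0 < t ->
  admissible_at lambda p t0 -> admissible_at lambda p t.
Proof.
move=> res p1 t00 tgt0 adm0.
have tt0 : 0 <= t / t0 by rewrite divr_ge0 // ltW.
(* Since [t / t0 < m], the time [t] is cut into [m.+1] slices of length [s <= t0]; the successor
   keeps the divisor nonzero. *)
pose m := Num.bound (t / t0).
have m0 : 0 < m.+1%:R :> R by rewrite ltr0n.
pose s := t / m.+1%:R.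
have s0 : 0 < s by rewrite divr_gt0.
have st0 : s <= t0.
  rewrite ler_pdivrMr // -ler_pdivrMl // mulrC (le_trans (ltW (archi_boundP tt0))) //.
  by rewrite ler_nat.
have adms : admissible_at lambda p s.
  have ts0 : 0 <= t0 - s by rewrite subr_ge0.
  by apply: (admissible_at_tail res p1 ts0 (ltW s0)); rewrite subrK.
have -> : t = m.+1%:R * s by rewrite mulrC divfK // gt_eqF.
(* [s] was defined from [m], so it is generalized: the induction counts slices of an arbitrary
   admissible length. *)
elim: m {m0 st0} s s0 adms => [|k IH] s s0 adms; first by rewrite mul1r.
rewrite -natr1 mulrDl mul1r; apply: admissible_atD => //; last exact: IH.
  by rewrite mulr_ge0 // ltW.
exact: ltW.
Qed.

Lemma controllability_mapE (lambda : K) (t : R) (u : R -> U) (x : X) :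
  has_integral (restr `[0, t] (ci lambda t u)) x ->
  controllability_map Am Q B T lambda t u = lambda *: x - Am x.
Proof.
move=> intx; rewrite /controllability_map.
by rewrite (bochner_integralE _ ((is_bochner_integralP _ _ _).2 intx)).
Qed.

(** The point 0 is exempt because the tail of a concatenation, read at 0, is the final value of the
    first control rather than the initial value of the second. *)
Lemma controllability_map_ae_eq (lambda : K) (p : \bar R) (t : R) (u w : R -> U) :
  admissible_at lambda p t -> Lp p t u ->
  (forall r, r != 0 -> 0 <= r -> r <= t -> u r = w r) ->
  controllability_map Am Q B T lambda t u = controllability_map Am Q B T lambda t w.
Proof.
move=> adm /adm[x _ intx] uw; rewrite (controllability_mapE intx).
apply/esym/controllability_mapE; apply: ae_eq_has_integral intx.
apply: (ae_neq (a := 0)) => r r0; rewrite /restr; case: ifP => // /set_mem /=.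
by rewrite in_itv /= => /andP[r_ge0 rt]; rewrite /control_integrand uw.
Qed.

Lemma controllability_mapD (lambda : K) (p : \bar R) (a b : R) (u : R -> U) :
  (1 <= p)%E -> 0 <= a -> 0 <= b ->
  admissible_at lambda p a -> admissible_at lambda p b -> Lp p (a + b) u ->
  controllability_map Am Q B T lambda (a + b) u =
  T b (controllability_map Am Q B T lambda a u) +
  controllability_map Am Q B T lambda b (fun s => u (s + a)).
Proof.
move=> p1 a0 b0 adma admb uLp.
have [x xA intx] := adma _ (Lp_head p1 b0 uLp).
have [y yA inty] := admb _ (Lp_tail p1 a0 uLp).
rewrite (controllability_mapE intx) (controllability_mapE inty).
rewrite (controllability_mapE (control_integralD a0 b0 intx inty)).
have [TxA TxE] := generator_semigroup_comm T_semigroup T_generator b0 xA.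
have [_] := dom_ker_linear 1 TxA yA; rewrite !scale1r => ->.
by rewrite [Am (T b x)]TxE /= linearB linearZ /= scalerDr opprD addrACA.
Qed.

Lemma exact_reachability_spaceD (lambda : K) (p : \bar R) (a b : R) :
  (1 <= p)%E -> 0 <= a -> 0 <= b ->
  admissible_at lambda p a -> admissible_at lambda p b ->
  exact_reachability_space Am Q B T lambda p (a + b) =
  [set z | exists y w, [/\ exact_reachability_space Am Q B T lambda p a y, Lp p b w &
    z = T b y + controllability_map Am Q B T lambda b w]].
Proof.
move=> p1 a0 b0 adma admb; apply/seteqP; split => [_ [u uLp <-]|z].
  rewrite (controllability_mapD p1 a0 b0 adma admb uLp).
  exists (controllability_map Am Q B T lambda a u), (fun s => u (s + a)).
  by split => //; [exists u => //; exact: Lp_head b0 uLp|exact: Lp_tail a0 uLp].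
move=> [_ [w [[u uLp <-] wLp ->]]].
have cLp := Lp_concatenation p1 a0 b0 uLp wLp.
exists (concatenation a u w) => //.
apply: (etrans (controllability_mapD p1 a0 b0 adma admb cLp)).
apply: (f_equal2 (fun v v' => T b v + v')).
  apply: (controllability_map_ae_eq adma (Lp_head p1 b0 cLp)) => r _ _ ra.
  by rewrite /concatenation ra.
apply: (controllability_map_ae_eq admb (Lp_tail p1 a0 cLp)) => r r0 r_ge0 _.
by rewrite /concatenation gerDr leNgt lt_def r0 r_ge0 /= addrK.
Qed.

Lemma exact_reachability_space_multiple (lambda : K) (p : \bar R) (t : R) (n : nat) :
  (1 <= p)%E -> 0 < t -> (forall s, 0 < s -> admissible_at lambda p s) ->
  exact_reachability_space Am Q B T lambda p (n.+1%:R * t) =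
  [set x | exists2 u : 'I_n.+1 -> R -> U, (forall k, Lp p t (u k)) &
    x = \sum_(k < n.+1)
      iter k (T t) (controllability_map Am Q B T lambda t (u k))].
Proof.
move=> p1 t0 adm; elim: n => [|n IH].
  rewrite mul1r; apply/seteqP; split => [_ [u uLp <-]|_ [u uLp ->]].
    by exists (fun=> u); rewrite // big_ord1.
  by exists (u ord0); rewrite // big_ord1.
have nt0 : 0 < n.+1%:R * t by rewrite mulr_gt0.
rewrite -natr1 mulrDl mul1r exact_reachability_spaceD ?(ltW nt0) ?(ltW t0) //; last 2 first.
- exact: adm.
- exact: adm.
rewrite IH; apply/seteqP; split => [_ [_ [w [[u uLp ->] wLp ->]]]|_ [u uLp ->]].
  (* The last control [w] is not propagated and takes index 0; the earlier ones gain a factor [T t],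
     so their indices move up by one. *)
  exists (fun k => if unlift ord0 k is Some j then u j else w).
    by move=> k; case: unliftP.
  rewrite [RHS]big_ord_recl unlift_none linear_sum /= addrC.
  by under [in RHS]eq_bigr do rewrite liftK.
exists (\sum_(k < n.+1) iter k (T t)
  (controllability_map Am Q B T lambda t (u (lift ord0 k)))), (u ord0); split => //.
  by exists (fun k => u (lift ord0 k)).
by rewrite [LHS]big_ord_recl linear_sum addrC.
Qed.

End Reachability.

Theorem corollary3p3 (R : realType) (K : scalarField R)
  (X dX U : completeNormedModType K)
  (Am : partial_op X) (Q : X -> dX) (B : {linear U -> dX})
  (T : R -> {linear X -> X})
  (Am_linear : linear_op Am) (Am_closed : closed_op Am)
  (Am_dense : dense (dom Am))
  (Q_bounded : graph_bounded Am Q) (B_bounded : continuous B)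
  (T_semigroup : C0_semigroup T)
  (T_generator : generator T (ker_restriction Am Q))
  (Q_surjective : forall v : dX, exists2 x : X, dom Am x & Q x = v)
  (p : \bar R) (p_ge1 : (1 <= p)%E)
  (B_admissible : boundary_admissible Am Q B T p)
  (t : R) (t_gt0 : 0 < t) (n : nat) (n_gt0 : (0 < n)%N)
  (lambda : K) (lambda_res : resolvent_set (ker_restriction Am Q) lambda) :
  let M := controllability_map Am Q B T lambda t in
  exact_reachability_space Am Q B T lambda p (n%:R * t) =
  [set x | exists2 u : 'I_n -> R -> U,
     (forall k, Lp p t (u k)) & x = \sum_(k < n) iter k (T t) (M (u k))].
Proof.
case: n n_gt0 => [//|n] _ /=.
apply: exact_reachability_space_multiple => // s s_gt0.
have [t0 [lambda0 [t0_gt0 res0 adm]]] := B_admissible.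
have adm0 : admissible_at Am Q B T lambda0 p t0.
  (* Integrability identifies the chosen value [bochner_integral] with the actual integral [x], so
     the domain condition speaks of [x]. *)
  move=> u /adm[[x intx]]; rewrite (bochner_integralE _ intx) // => xA.
  by exists x => //; exact/is_bochner_integralP.
apply: (admissible_at_all _ _ _ _ _ _ p_ge1 t0_gt0 s_gt0) => //.
exact: (admissible_at_resolvent _ _ _ _ _ lambda_res res0).
Qed.
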